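(* Let $L>0$ and $k>0$ with $kL\in 2\pi\mathbb{Z}$. There exists $\alpha_0\in(0,1)$ such that for every real $\alpha$ with $|\alpha|\le\alpha_0$ the following holds. Let $f(t,x,v)$, $t\ge 0$, $x\in[0,L]$, $v\in\mathbb{R}$, be the (classical, $L$-periodic in $x$) solution of the one-dimensional Vlasov--Poisson system $$\frac{\partial f}{\partial t}+v\frac{\partial f}{\partial x}-E\frac{\partial f}{\partial v}=0,\qquad E=-\frac{\partial \phi}{\partial x},\qquad -\frac{\partial^2\phi}{\partial x^2}=\rho_0-\rho,\qquad \rho(t,x)=\int_{\mathbb{R}}f(t,x,v)\,\mathrm{d}v,$$ with periodic boundary conditions in $x$ on $[0,L]$ and initial condition $$f(0,x,v)=f_0(x,v)=\frac{1+\alpha\cos(kx)}{\sqrt{2\pi}}\,e^{-v^2/2}.$$ Then for all $x\in[0,L]$ and all $t>0$, $$\|f(t,x,\cdot)\|_{\omega_\beta}<\infty\quad\text{for all }\beta\in(0,\sqrt{2}),\qquad \|f(t,x,\cdot)\|_{\omega_\beta}=\infty\quad\text{for all }\beta\in(\sqrt{2},\infty).$$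
   Context: For $\beta>0$ let $\omega_\beta(v)=e^{\beta^2v^2/2}$ and, for a measurable function $u:\mathbb{R}\to\mathbb{R}$, $\|u\|_{\omega_\beta}^2=\int_{\mathbb{R}}|u(v)|^2\,\omega_\beta(v)\,\mathrm{d}v\in[0,\infty]$. Here $\rho_0$ is the constant background ion density, satisfying the neutrality condition $\int_0^L(\rho_0-\rho)\,\mathrm{d}x=0$ (so $\rho_0=1$ for this initial condition). The potential $\phi$ and hence the electric field $E$ are $L$-periodic in $x$. *)

(* Defs.v *)
From HB Require Import structures.
From mathcomp Require Import all_boot all_order all_algebra.
From mathcomp Require Import all_classical all_reals all_analysis.
Import Order.TTheory GRing.Theory Num.Theory.
Import numFieldNormedType.Exports.

Set Implicit Arguments.
Unset Strict Implicit.
Unset Printing Implicit Defensive.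

Local Open Scope classical_set_scope.
Local Open Scope ring_scope.

Definition omega (R : realType) (beta v : R) : R :=
  expR (beta ^+ 2 * v ^+ 2 / 2).

(* Extended-real valued: [+oo] when [u] is not square integrable for the weight. *)
Definition wnorm (R : realType) (beta : R) (u : R -> R) : \bar R :=
  sqrte (\int[@lebesgue_measure R]_v (`|u v| ^+ 2 * omega beta v)%:E)%E.

Definition perturbed_maxwellian (R : realType) (alpha k x v : R) : R :=
  (1 + alpha * cos (k * x)) / Num.sqrt (2 * pi) * expR (- (v ^+ 2 / 2)).

Definition density (R : realType) (f : R -> R -> R -> R) (t x : R) : R :=
  \int[@lebesgue_measure R]_v f t x v.

Definition electric_field (R : realType) (phi : R -> R -> R) (t x : R) : R :=
  - derive1 (phi t) x.

Definition dt (R : realType) (f : R -> R -> R -> R) (t x v : R) : R :=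
  derive1 (fun s => f s x v) t.
Definition dx (R : realType) (f : R -> R -> R -> R) (t x v : R) : R :=
  derive1 (fun y => f t y v) x.
Definition dv (R : realType) (f : R -> R -> R -> R) (t x v : R) : R :=
  derive1 (f t x) v.

(* [L]-periodic functions of x in [0, L] are represented by [L]-periodic
   functions on the whole line; values at times [t < 0] are irrelevant.
   "Classical" means that all derivatives in the system exist and are
   continuous: those of [f] for [t > 0] (with [f] itself continuous up to
   [t = 0]), those of the potential for [t >= 0]. *)
Record vlasov_poisson_solution (R : realType) (L rho0 : R) (f0 : R -> R -> R)
    (f : R -> R -> R -> R) (phi : R -> R -> R) : Prop := VlasovPoissonSolution {
  vp_f_periodic : forall t x v : R, 0 <= t -> f t (x + L) v = f t x v ;
  vp_phi_periodic : forall t x : R, 0 <= t -> phi t (x + L) = phi t x ;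
  vp_f_continuous :
    {within [set p : R * R * R | 0 <= p.1.1],
      continuous (fun p : R * R * R => f p.1.1 p.1.2 p.2)} ;
  vp_f_derivable : forall t x v : R, 0 < t ->
    [/\ derivable (fun s => f s x v) t 1,
        derivable (fun y => f t y v) x 1 &
        derivable (f t x) v 1] ;
  vp_f_C1 :
    [/\ {within [set p : R * R * R | 0 < p.1.1],
          continuous (fun p : R * R * R => dt f p.1.1 p.1.2 p.2)},
        {within [set p : R * R * R | 0 < p.1.1],
          continuous (fun p : R * R * R => dx f p.1.1 p.1.2 p.2)} &
        {within [set p : R * R * R | 0 < p.1.1],
          continuous (fun p : R * R * R => dv f p.1.1 p.1.2 p.2)}] ;
  vp_f_integrable : forall t x : R, 0 <= t ->
    (@lebesgue_measure R).-integrable setT (fun v => (f t x v)%:E) ;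
  vp_phi_derivable : forall t x : R, 0 <= t ->
    derivable (phi t) x 1 /\ derivable (derive1 (phi t)) x 1 ;
  vp_phi_C2 :
    {within [set p : R * R | 0 <= p.1],
      continuous (fun p : R * R => derive1 (phi p.1) p.2)} /\
    {within [set p : R * R | 0 <= p.1],
      continuous (fun p : R * R => derive1 (derive1 (phi p.1)) p.2)} ;
  vp_vlasov : forall t x v : R, 0 < t ->
    dt f t x v + v * dx f t x v - electric_field phi t x * dv f t x v = 0 ;
  vp_poisson : forall t x : R, 0 <= t ->
    - derive1 (derive1 (phi t)) x = rho0 - density f t x ;
  vp_neutrality : forall t : R, 0 <= t ->
    \int[@lebesgue_measure R]_(x in `[0, L]) (rho0 - density f t x) = 0 ;
  vp_initial : forall x v : R, f 0 x v = f0 x v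
}.

(* Main.v *)
Require Import Defs.
From HB Require Import structures.
From mathcomp Require Import all_boot all_order all_algebra.
From mathcomp Require Import all_classical all_reals all_analysis.
From mathcomp Require Import measurable_realfun ring lra.
Import Order.TTheory GRing.Theory Num.Theory.
Import numFieldNormedType.Exports.

(** A density transported by the Vlasov equation is constant along
characteristics, along which the velocity moves by at most [a = M * t], where
[M] bounds the field on [[0, t]].  Such a bound exists because the field is
continuous and periodic in space.  Hence [f t x v] lies between the infimum and
the supremum of the initial datum over velocities within [a] of [v], so that it
is comparable to a Maxwellian evaluated at [v] up to a bounded shift.  A bounded
shift changes the exponent [v ^+ 2 / 2] by a term linear in [v], which any small
multiple of [v ^+ 2] absorbs ([sqr_peter_paul]).  Therefore the integrand
[`|f t x v| ^+ 2 * omega beta v] behaves like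
[expR ((beta ^+ 2 / 2 - 1) * v ^+ 2)] up to an arbitrarily small relative error
in the exponent: it is dominated by an integrable Gaussian when
[beta ^+ 2 < 2] and bounded below by a positive constant when [beta ^+ 2 > 2].

The comparison with the initial datum is obtained without integrating the
characteristic flow, by a maximum principle on a cone of dependence
([transport_max_principle]).  On the compact set of points [(s, y, w)] with
[`|w - v| <= M * (T - s)], the penalized function [f - d * s] attains its
maximum.  At a point with [s > 0], stepping backwards in the direction
[(-1, - w, E)] stays in the cone, because the field is bounded by [M], and
strictly increases the penalized function, because [f] has zero derivative in
that direction.  So the maximum is at [s = 0], and [d] is arbitrary.  Applied to
[f] and to [- f], this gives the two-sided bounds
[vlasov_poisson_gaussian_bounds]. *)

Set Implicit Arguments.
Unset Strict Implicit.
Unset Printing Implicit Defensive.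

Local Open Scope classical_set_scope.
Local Open Scope ring_scope.

(** * Periodic functions *)

Lemma periodic_int {U : zmodType} {V : Type} (g : U -> V) (T : U) :
  (forall x, g (x + T) = g x) -> forall (n : int) x, g (x + T *~ n) = g x.
Proof.
move=> gT; have gn (n : nat) x : g (x + T *+ n) = g x.
  by elim: n => [|n IHn]; rewrite ?addr0 // mulrSr addrA gT.
case=> n x; first exact: gn.
by rewrite NegzE mulrNz -[in RHS](subrK (T *~ n.+1) x) gn.
Qed.

Lemma periodic_reduce {R : realType} {V : Type} (L : R) (g : R -> V) :
  0 < L -> (forall x, g (x + L) = g x) ->
  forall x, exists2 y, 0 <= y <= L & g y = g x.
Proof.
move=> L0 gL x; exists (x - L *~ Num.floor (x / L)); last first.
  by rewrite -mulrNz periodic_int.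
have /andP[le_x lt_x] := floor_itv (x / L).
rewrite ler_pdivlMr // in le_x; rewrite ltr_pdivrMr // intrD mulrDl in lt_x.
rewrite -mulrzl; lra.
Qed.

Lemma derive1_periodic {R : realType} (L : R) (g : R -> R) :
  (forall x, g (x + L) = g x) -> forall x, derive1 g (x + L) = derive1 g x.
Proof.
move=> gL x; rewrite !derive1E /derive.
suff -> : (fun h : R => h^-1 *: (g (h *: 1 + (x + L)) - g (x + L))) =
          (fun h : R => h^-1 *: (g (h *: 1 + x) - g x)) by [].
by apply/funext => h; rewrite addrA !gL.
Qed.

(** * First-order expansion of a function with continuous partial derivatives *)

(** The mean value theorem for increments of either sign, which the coordinate
steps of [increment_along_line] may have. *)
Lemma mvt_increment {R : realType} (g : R -> R) (a b : R) :
  (forall c, `|c - a| <= `|b - a| -> derivable g c 1) ->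
  exists2 c, `|c - a| <= `|b - a| & g b - g a = derive1 g c * (b - a).
Proof.
move=> dg; have mvt (u w : R) : u <= w ->
    (forall c, u <= c <= w -> `|c - a| <= `|b - a|) ->
    exists2 c, `|c - a| <= `|b - a| & g w - g u = derive1 g c * (w - u).
  move=> uw near_a; have [||c /itvP cI ->] :=
    @MVT_segment R g (derive1 g) u w uw.
  - move=> c /itvP cI; rewrite derive1E; apply: DeriveDef => //.
    by apply/dg/near_a; rewrite !cI.
  - apply: derivable_within_continuous => c /itvP cI.
    by apply/dg/near_a; rewrite !cI.
  by exists c => //; apply: near_a; rewrite !cI.
have [ab|/ltW ba] := leP a b.
  apply: mvt => // c /andP[ac cb]; rewrite !ger0_norm ?subr_ge0 //; lra.
have [c /andP[bc ca]|c ca gE] := mvt b a ba.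
  by rewrite !ler0_norm ?subr_le0 //; lra.
by exists c => //; rewrite -[LHS]opprB gE -mulrN opprB.
Qed.

Lemma continuous_fst_fst {R : realType} :
  continuous (fun q : R * R * R => q.1.1).
Proof. by move=> q; apply: continuous_comp; exact: cvg_fst. Qed.

Lemma norm_sum3_le {R : realType} (e p q r x y z : R) :
  `|p| <= e -> `|q| <= e -> `|r| <= e ->
  `|p * x + q * y + r * z| <= e * (`|x| + `|y| + `|z|).
Proof.
move=> pe qe re; rewrite !mulrDr.
rewrite (le_trans (ler_normD _ _)) // lerD //; last first.
  by rewrite normrM ler_wpM2r.
by rewrite (le_trans (ler_normD _ _)) // lerD // normrM ler_wpM2r.
Qed.

Lemma continuous_near_dist {R : realType} (F : R * R * R -> R) (p : R * R * R)
    (e : R) :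
  {within [set q | 0 < q.1.1], continuous F} -> 0 < p.1.1 -> 0 < e ->
  \forall q \near p, `|F q - F p| < e.
Proof.
move=> Fc p0 e0; have op : open [set q : R * R * R | 0 < q.1.1].
  rewrite (_ : mkset _ = (fun q => q.1.1) @^-1` [set y | 0 < y]) //.
  apply: open_comp; last exact: open_gt.
  by move=> q _; exact: continuous_fst_fst.
move: Fc; rewrite continuous_open_subspace // => Fc.
have /cvgrPdist_lt/(_ e e0) : {for p, continuous F} by apply: Fc; rewrite inE.
by apply: filterS => q; rewrite distrC.
Qed.

(** The part of the system that the maximum principle uses.  The field [E] is
only a coefficient here, which makes the notion stable under [f |-> - f] and so
yields lower bounds from upper bounds. *)
Record transport_solution {R : realType} (L : R) (E : R -> R -> R)
    (f : R -> R -> R -> R) : Prop := TransportSolution {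
  ts_periodic : forall t x v : R, 0 <= t -> f t (x + L) v = f t x v ;
  ts_continuous : {within [set p : R * R * R | 0 <= p.1.1],
    continuous (fun p : R * R * R => f p.1.1 p.1.2 p.2)} ;
  ts_derivable : forall t x v : R, 0 < t ->
    [/\ derivable (fun s => f s x v) t 1,
        derivable (fun y => f t y v) x 1 & derivable (f t x) v 1] ;
  ts_dt_continuous : {within [set p : R * R * R | 0 < p.1.1],
    continuous (fun p : R * R * R => dt f p.1.1 p.1.2 p.2)} ;
  ts_dx_continuous : {within [set p : R * R * R | 0 < p.1.1],
    continuous (fun p : R * R * R => dx f p.1.1 p.1.2 p.2)} ;
  ts_dv_continuous : {within [set p : R * R * R | 0 < p.1.1],
    continuous (fun p : R * R * R => dv f p.1.1 p.1.2 p.2)} ;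
  ts_equation : forall t x v : R, 0 < t ->
    dt f t x v + v * dx f t x v - E t x * dv f t x v = 0
}.

(** Differentiability along straight lines does not follow from the existence of
partial derivatives alone.  The increment is split into one step per coordinate;
the mean value theorem turns each step into a partial derivative at a nearby
point, which continuity compares with its value at the base point. *)
Lemma increment_along_line {R : realType} (L : R) (E : R -> R -> R)
    (f : R -> R -> R -> R) (t x v a b c e : R) :
  transport_solution L E f -> 0 < t -> 0 < e ->
  \forall h \near (0 : R), `|f (t + a * h) (x + b * h) (v + c * h) - f t x v
    - (a * dt f t x v + b * dx f t x v + c * dv f t x v) * h| <= e * `|h|.
Proof.
case=> _ _ df cdt cdx cdv _ t0 e0.
(* [S * `|h|] bounds all coordinate increments, and their sum; the summand 1
   keeps [S] positive when the direction vanishes *)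
pose S : R := `|a| + `|b| + `|c| + 1.
have [[a0 b0] c0] := (normr_ge0 a, normr_ge0 b, normr_ge0 c).
have S0 : 0 < S by rewrite /S; lra.
pose e' := e / S; have e'0 : 0 < e' by rewrite divr_gt0.
have p0 : 0 < (t, x, v).1.1 by [].
have /nbhs_ballP[r /= r0 near_p] : \forall q \near (t, x, v), [/\ 0 < q.1.1,
    `|dt f q.1.1 q.1.2 q.2 - dt f t x v| < e',
    `|dx f q.1.1 q.1.2 q.2 - dx f t x v| < e' &
    `|dv f q.1.1 q.1.2 q.2 - dv f t x v| < e'].
  have t_pos : \forall q \near (t, x, v), 0 < q.1.1.
    exact: (cvgr_gt _ (@continuous_fst_fst R (t, x, v))).
  have ndt := continuous_near_dist cdt p0 e'0.
  have ndx := continuous_near_dist cdx p0 e'0.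
  have ndv := continuous_near_dist cdv p0 e'0.
  apply: filterS (filterI (filterI t_pos ndt) (filterI ndx ndv)).
  by move=> q [[q0 qt] [qx qv]]; exact: And4 q0 qt qx qv.
have {}near_p s y w : `|s - t| < r -> `|y - x| < r -> `|w - v| < r ->
    [/\ 0 < s, `|dt f s y w - dt f t x v| < e',
    `|dx f s y w - dx f t x v| < e' & `|dv f s y w - dv f t x v| < e'].
  move=> st yx wv; apply: (near_p (s, y, w)).
  by split; [split|]; rewrite /ball /= distrC.
apply/nbhs_ballP; exists (r / S) => [/=|h]; first by rewrite divr_gt0.
rewrite -ball_normE /= sub0r normrN ltr_pdivlMr // => hr.
have h0 := normr_ge0 h.
have Sh : `|h| * S = `|a * h| + `|b * h| + `|c * h| + `|h|.
  by rewrite !normrM /S; ring.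
have [ah0 [bh0 ch0]] :=
  (normr_ge0 (a * h), (normr_ge0 (b * h), normr_ge0 (c * h))).
have ah : `|a * h| < r by lra.
have bh : `|b * h| < r by lra.
have ch : `|c * h| < r by lra.
have near0 : `|t - t| < r by rewrite subrr normr0.
have near0x : `|x - x| < r by rewrite subrr normr0.
have near0v : `|v - v| < r by rewrite subrr normr0.
have shift_id (z u : R) : z + u - z = u by ring.
have [s st Es] : exists2 s, `|s - t| < r &
    f (t + a * h) (x + b * h) (v + c * h) - f t (x + b * h) (v + c * h) =
    dt f s (x + b * h) (v + c * h) * (a * h).
  have [s|s] := @mvt_increment R (fun s => f s (x + b * h) (v + c * h))
      t (t + a * h); rewrite shift_id => st.
  - have [s0 _ _ _] := near_p s x v (le_lt_trans st ah) near0x near0v.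
    case: (df s (x + b * h) (v + c * h) s0) => ds _ _; exact: ds.
  - by move=> ->; exists s => //; exact: le_lt_trans ah.
have [y yx Ey] : exists2 y, `|y - x| < r &
    f t (x + b * h) (v + c * h) - f t x (v + c * h) =
    dx f t y (v + c * h) * (b * h).
  have [y|y] := @mvt_increment R (fun y => f t y (v + c * h)) x (x + b * h);
      rewrite shift_id => yx.
  - case: (df t y (v + c * h) t0) => _ dy _; exact: dy.
  - by move=> ->; exists y => //; exact: le_lt_trans bh.
have [w wv Ew] : exists2 w, `|w - v| < r &
    f t x (v + c * h) - f t x v = dv f t x w * (c * h).
  have [w|w] := @mvt_increment R (f t x) v (v + c * h); rewrite shift_id => wv.
  - case: (df t x w t0) => _ _ dw; exact: dw.
  - by move=> ->; exists w => //; exact: le_lt_trans ch.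
have [||_ Dt _ _] := near_p s (x + b * h) (v + c * h) st;
  rewrite ?shift_id //.
have [|_ _ Dx _] := near_p t y (v + c * h) near0 yx; rewrite ?shift_id //.
have [_ _ _ Dv] := near_p t x w near0 near0x wv.
rewrite (_ : _ - _ = (dt f s (x + b * h) (v + c * h) - dt f t x v) * (a * h)
  + (dx f t y (v + c * h) - dx f t x v) * (b * h)
  + (dv f t x w - dv f t x v) * (c * h)); last first.
  by rewrite 3!mulrBl -Es -Ey -Ew; ring.
apply: (@le_trans _ _ (e' * (`|a * h| + `|b * h| + `|c * h|))).
  exact: norm_sum3_le (ltW Dt) (ltW Dx) (ltW Dv).
have -> : e = e' * S by rewrite divfK // gt_eqF.
rewrite -mulrA; apply: ler_wpM2l; first exact: ltW e'0.
by rewrite [S * _]mulrC Sh; lra.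
Qed.

Lemma transport_solutionN {R : realType} (L : R) (E : R -> R -> R)
    (f : R -> R -> R -> R) : transport_solution L E f ->
  transport_solution L E (fun t x v => - f t x v).
Proof.
move=> [fL fc df cdt cdx cdv feq].
have dtN t x v : 0 < t -> dt (fun t x v => - f t x v) t x v = - dt f t x v.
  by move=> t0; have [d _ _] := df t x v t0; rewrite /dt !derive1E deriveN.
have dxN t x v : 0 < t -> dx (fun t x v => - f t x v) t x v = - dx f t x v.
  by move=> t0; have [_ d _] := df t x v t0; rewrite /dx !derive1E deriveN.
have dvN t x v : 0 < t -> dv (fun t x v => - f t x v) t x v = - dv f t x v.
  by move=> t0; have [_ _ d] := df t x v t0; rewrite /dv !derive1E deriveN.
have withinN (g h : R * R * R -> R) :
    (forall p, 0 < p.1.1 -> g p = - h p) ->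
    {within [set p | 0 < p.1.1], continuous h} ->
    {within [set p | 0 < p.1.1], continuous g}.
  move=> gh hc; apply: (@subspace_eq_continuous _ _ _ (fun p => - h p)).
    by move=> p; rewrite inE => p0; symmetry; exact: gh.
  by move=> p; apply: continuousN; exact: hc.
split.
- by move=> t x v t0; rewrite fL.
- by move=> p; apply: continuousN; exact: fc.
- by move=> t x v t0; have [? ? ?] := df t x v t0; split; exact: derivableN.
- by apply: withinN cdt => p; exact: dtN.
- by apply: withinN cdx => p; exact: dxN.
- by apply: withinN cdv => p; exact: dvN.
- move=> t x v t0; rewrite dtN // dxN // dvN //.
  by rewrite -[RHS]oppr0 -(feq t x v t0); ring.
Qed.

(** * Maximum principle for transport equations *)

(** Velocities are confined to a cone of slope [M], the bound on the
acceleration.  Positions range over one full period, whose compactness makes a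
spatial cone, with a slope depending on [v], superfluous. *)
Definition dependence_cone {R : realType} (L T M v : R) : set (R * R * R) :=
  [set p | [/\ 0 <= p.1.1 <= T, 0 <= p.1.2 <= L &
               `|p.2 - v| <= M * (T - p.1.1)]].

Lemma compact_dependence_cone {R : realType} (L T M v : R) : 0 <= M ->
  compact (dependence_cone L T M v).
Proof.
move=> M0; have -> : dependence_cone L T M v =
    ((`[0, T] `*` `[0, L]) `*` `[v - M * T, v + M * T]) `&`
    [set p | `|p.2 - v| + M * p.1.1 <= M * T].
  rewrite /dependence_cone; apply/seteqP.
  split=> [[[s y] w] /= [/andP[s0 sT] yL wv]|[[s y] w] /=].
    rewrite mulrBr in wv; have Ms := mulr_ge0 M0 s0.
    have /andP[wl wr] : - (M * T - M * s) <= w - v <= M * T - M * s.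
      by rewrite -ler_norml.
    rewrite !in_itv /= s0 sT yL; split; last by lra.
    by split=> //; apply/andP; split; lra.
  by rewrite !in_itv /= => -[[[sT yL] _] wv]; split => //; rewrite mulrBr; lra.
apply: compact_closedI.
  by apply: compact_setX; [apply: compact_setX|]; exact: segment_compact.
rewrite (_ : mkset _ = (fun p : R * R * R => `|p.2 - v| + M * p.1.1) @^-1`
  [set z | z <= M * T]) //.
apply: closed_comp; last exact: closed_le.
move=> p _; apply: cvgD; last by apply: cvgMr; exact: continuous_fst_fst.
by apply: cvg_norm; apply: cvgB; [exact: cvg_snd|exact: cvg_cst].
Qed.

(** On the cone, [f] minus a small multiple of time is maximal at time 0:
from any later point, a small step backwards along the characteristic direction
stays in the cone and increases that function. *)
Lemma transport_max_principle {R : realType} (L : R) (E : R -> R -> R)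
    (f : R -> R -> R -> R) (T M B x v : R) :
  0 < L -> 0 < T -> transport_solution L E f ->
  (forall s y, 0 <= s <= T -> `|E s y| <= M) ->
  (forall y w, `|w - v| <= M * T -> f 0 y w <= B) ->
  f T x v <= B.
Proof.
move=> L0 T0 fS EM fB.
have M0 : 0 <= M by apply: le_trans (normr_ge0 _) (EM 0 0 _); rewrite lexx ltW.
have [x' x'L x'E] := @periodic_reduce R R L (fun y => f T y v) L0
  (fun y => ts_periodic fS y v (ltW T0)) x.
rewrite -x'E; apply/ler_addgt0Pr => e e0.
(* the penalty [d * s] loses exactly [e] between times 0 and [T] *)
pose d := e / T; have d0 : 0 < d by rewrite divr_gt0.
pose K := dependence_cone L T M v.
pose F (p : R * R * R) : R := f p.1.1 p.1.2 p.2 - d * p.1.1.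
have top : K ((T, x'), v).
  by split=> //=; [rewrite lexx ltW|rewrite !subrr normr0 mulr0].
have Fc : {within K, continuous F}.
  apply: (@continuous_subspaceW _ _ K [set p : R * R * R | 0 <= p.1.1]).
    by move=> p [/andP[]].
  move=> p; apply: cvgB; first exact: (ts_continuous fS).
  have tc : continuous (fun q : R * R * R => d * q.1.1).
    by move=> q; apply: cvgMr; exact: continuous_fst_fst.
  exact: (@continuous_subspaceT _ _ _ _ tc p).
have [[[s y] w]] := compact_EVT_max (ex_intro _ _ top)
  (@compact_dependence_cone R L T M v M0) Fc.
rewrite inE /K /dependence_cone /= => -[/andP[s0 sT] yL wv] Fmax.
(* either the maximum lies on the initial slice, or a backward step beats it *)
have [s0'|s_gt0] := leP s 0.
  have s_eq0 : s = 0 by lra.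
  have := Fmax (T, x', v) (mem_set top).
  rewrite /F /= s_eq0 mulr0 subr0 divfK ?gt_eqF // => fT.
  have := fB y w; rewrite s_eq0 subr0 in wv => /(_ wv); lra.
exfalso.
have d20 : 0 < d / 2 by lra.
(* the step gains [d * h] from the penalty and loses at most [d / 2 * h] *)
have /nbhs_ballP[r /= r0 near_h] :=
  increment_along_line y w (-1) (- w) (E s y) fS s_gt0 d20.
pose h := Num.min (r / 2) s.
have h0 : 0 < h by rewrite lt_min s_gt0 andbT divr_gt0.
have hs : h <= s by rewrite ge_min lexx orbT.
have hr : h <= r / 2 by rewrite ge_min lexx.
have := near_h h; rewrite -ball_normE /= sub0r normrN gtr0_norm //.
have -> : (-1 * dt f s y w + - w * dx f s y w + E s y * dv f s y w) * h = 0.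
  by rewrite -(mul0r h) -[in RHS]oppr0 -(ts_equation fS y w s_gt0); ring.
rewrite subr0 => decr_h.
have /decr_h : h < r by lra.
rewrite ler_norml => /andP[decr _].
have sh0 : 0 <= s + -1 * h by lra.
(* the step may leave the period cell, so it is translated back *)
have [y' y'L y'E] := @periodic_reduce R R L
  (fun z => f (s + -1 * h) z (w + E s y * h)) L0
  (fun z => ts_periodic fS z _ sh0) (y + - w * h).
have dh := mulr_gt0 d0 h0.
have Esy : `|E s y| <= M by apply: EM; lra.
have := Fmax (s + -1 * h, y', w + E s y * h).
rewrite /F /= y'E inE => Fle.
suff /Fle : K (s + -1 * h, y', w + E s y * h) by lra.
rewrite /K /dependence_cone; split=> //=; first lra.
rewrite [_ - v](_ : _ = (w - v) + E s y * h); last ring.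
rewrite (le_trans (ler_normD _ _)) // normrM (gtr0_norm h0).
rewrite [leRHS](_ : _ = M * (T - s) + M * h); last ring.
by rewrite lerD // ler_wpM2r // ltW.
Qed.

(** * Maxwellian bounds on the density *)

Lemma vlasov_poisson_transport {R : realType} (L rho0 : R) (f0 : R -> R -> R)
    (f : R -> R -> R -> R) (phi : R -> R -> R) :
  vlasov_poisson_solution L rho0 f0 f phi ->
  transport_solution L (electric_field phi) f.
Proof.
by move=> [fL _ fc df [cdt cdx cdv] _ _ _ feq _ _ _]; split.
Qed.

(** Periodicity makes the bound, obtained by compactness on one period, hold on
the whole line. *)
Lemma electric_field_bounded {R : realType} (L rho0 : R) (f0 : R -> R -> R)
    (f : R -> R -> R -> R) (phi : R -> R -> R) (T : R) :
  0 < L -> 0 <= T -> vlasov_poisson_solution L rho0 f0 f phi ->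
  exists M, forall s y, 0 <= s <= T -> `|electric_field phi s y| <= M.
Proof.
move=> L0 T0 [_ phiL _ _ _ _ _ [phic _] _ _ _ _].
pose K : set (R * R) := `[0, T] `*` `[0, L].
have K0 : K (0, 0) by split; rewrite /= in_itv /= lexx //= ltW.
have Kc : compact K by apply: compact_setX; exact: segment_compact.
have Ec : {within K, continuous (fun p : R * R => `|derive1 (phi p.1) p.2|)}.
  apply: (@continuous_subspaceW _ _ K [set p : R * R | 0 <= p.1]).
    by move=> p [/=]; rewrite in_itv /= => /andP[].
  by move=> p; apply: cvg_norm; exact: phic.
have [[s y] _ Emax] := compact_EVT_max (ex_intro _ _ K0) Kc Ec.
exists `|derive1 (phi s) y| => s' y' s'T; rewrite /electric_field normrN.
have s'0 : 0 <= s' by case/andP: s'T.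
have [z zL <-] := @periodic_reduce R R L (derive1 (phi s')) L0
  (derive1_periodic (fun y => phiL s' y s'0)) y'.
apply: (Emax (s', z)); rewrite inE; split; rewrite /= in_itv //=.
Qed.

(** The cross term of [(v + (w - v)) ^+ 2] is split by the weighted arithmetic
and geometric mean inequality; the weight [d] trades the growth in [v] against
the constant. *)
Lemma sqr_peter_paul {R : realFieldType} (a d v w : R) : 0 < d ->
  `|w - v| <= a -> w ^+ 2 <= (1 + d) * v ^+ 2 + (1 + d^-1) * a ^+ 2.
Proof.
move=> d0 wv; have a0 : 0 <= a by apply: le_trans wv.
have z2 : (w - v) ^+ 2 <= a ^+ 2.
  by rewrite -[leLHS]real_normK ?num_real // ler_pXn2r // nnegrE.
have zd : (1 + d^-1) * (w - v) ^+ 2 <= (1 + d^-1) * a ^+ 2.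
  by rewrite ler_wpM2l // addr_ge0 // invr_ge0 ltW.
apply: le_trans (lerD (lexx _) zd); rewrite -subr_ge0.
rewrite (_ : _ - _ = d^-1 * (d * v - (w - v)) ^+ 2).
  by rewrite mulr_ge0 ?sqr_ge0 // invr_ge0 ltW.
by field; rewrite gt_eqF.
Qed.

Lemma perturbed_maxwellian_bounds {R : realType} (alpha k x v : R) :
  `|alpha| <= 2^-1 ->
  2^-1 / Num.sqrt (2 * pi) * expR (- (v ^+ 2 / 2)) <=
    perturbed_maxwellian alpha k x v <=
  2 / Num.sqrt (2 * pi) * expR (- (v ^+ 2 / 2)).
Proof.
move=> alpha_le; have : `|alpha * cos (k * x)| <= 2^-1.
  rewrite normrM -[leRHS]mulr1 ler_pM //.
  by rewrite ler_norml cos_le1 cos_geN1.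
rewrite ler_norml => /andP[lo hi].
rewrite /perturbed_maxwellian; apply/andP.
by split; rewrite ler_wpM2r ?expR_ge0 // ler_wpM2r ?invr_ge0 ?sqrtr_ge0 //; lra.
Qed.

(** The Maxwellian is a decreasing function of [w ^+ 2], so bounds [m] on the
squared velocities within the reachable distance [a] of [v] are all that the
estimates of [f t x v] need. *)
Lemma vlasov_poisson_gaussian_bounds {R : realType} (L alpha k rho0 : R)
    (f : R -> R -> R -> R) (phi : R -> R -> R) (x t : R) :
  0 < L -> 0 < t -> `|alpha| <= 2^-1 ->
  vlasov_poisson_solution L rho0 (perturbed_maxwellian alpha k) f phi ->
  exists a, forall v m,
    ((forall w, `|w - v| <= a -> m <= w ^+ 2) ->
      f t x v <= 2 / Num.sqrt (2 * pi) * expR (- (m / 2))) /\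
    ((forall w, `|w - v| <= a -> w ^+ 2 <= m) ->
      2^-1 / Num.sqrt (2 * pi) * expR (- (m / 2)) <= f t x v).
Proof.
move=> L0 t0 alpha_le fS.
have [M EM] := electric_field_bounded L0 (ltW t0) fS.
have tS := vlasov_poisson_transport fS.
have N0 : 0 <= (Num.sqrt (2 * pi) : R)^-1 by rewrite invr_ge0 sqrtr_ge0.
exists (M * t) => v m; split=> mP.
  apply: (transport_max_principle x L0 t0 tS EM) => y w wv.
  rewrite (vp_initial fS).
  have /andP[_ fle] := perturbed_maxwellian_bounds k y w alpha_le.
  apply: le_trans fle _; rewrite ler_wpM2l ?mulr_ge0 // ler_expR.
  by have := mP w wv; lra.
rewrite -lerN2.
apply: (transport_max_principle x L0 t0 (transport_solutionN tS) EM) => y w wv.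
rewrite lerN2 (vp_initial fS).
have /andP[fle _] := perturbed_maxwellian_bounds k y w alpha_le.
apply: le_trans fle; rewrite ler_wpM2l ?mulr_ge0 // ler_expR.
by have := mP w wv; lra.
Qed.

(** * Finiteness and divergence of the weighted norm *)

Lemma measurable_wnorm_integrand {R : realType} (beta : R) (u : R -> R) :
  measurable_fun [set: R] u ->
  measurable_fun [set: R] (fun v => `|u v| ^+ 2 * omega beta v).
Proof.
move=> mu; apply: measurable_funM.
  by apply: measurable_funX; exact: measurableT_comp.
apply: measurableT_comp => //; apply: measurable_funM => //.
by apply: measurable_funM => //; exact: measurable_funX.
Qed.

Lemma omega_integrand_ge0 {R : realType} (beta : R) (u : R -> R) (v : R) :
  (0 <= (`|u v| ^+ 2 * omega beta v)%:E)%E.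
Proof. by rewrite lee_fin mulr_ge0 ?expR_ge0 // exprn_ge0. Qed.

Lemma wnorm_lt_pinfty {R : realType} (beta C c : R) (u : R -> R) :
  measurable_fun [set: R] u -> 0 <= C -> 0 < c ->
  (forall v, `|u v| ^+ 2 * omega beta v <= C * expR (- (c * v ^+ 2))) ->
  (wnorm beta u < +oo)%E.
Proof.
move=> mu C0 c0 ub.
(* the standard deviation of the normal law whose density is proportional to
   the bound *)
pose s := Num.sqrt (2 * c)^-1.
have s2 : s ^+ 2 = (2 * c)^-1 by rewrite sqr_sqrtr // invr_ge0 mulr_ge0 // ltW.
have s0 : s != 0 by rewrite sqrtr_eq0 -ltNge invr_gt0 mulr_gt0.
have peak0 := normal_peak_gt0 s0.
have gaussE v : C * expR (- (c * v ^+ 2)) =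
    C / normal_peak s * normal_pdf 0 s v.
  rewrite normal_pdfE //= [RHS]mulrA divfK ?gt_eqF // /normal_fun subr0 s2.
  by congr (C * expR _); field; rewrite gt_eqF.
have C'0 : 0 <= C / normal_peak s by rewrite divr_ge0 // ltW.
rewrite ltey_eq; apply/orP; left; rewrite /wnorm sqrte_fin_num; last first.
  by apply: integral_ge0 => v _; exact: omega_integrand_ge0.
rewrite ge0_fin_numE; last first.
  by apply: integral_ge0 => v _; exact: omega_integrand_ge0.
apply: (@le_lt_trans _ _ (\int[@lebesgue_measure R]_v
    ((C / normal_peak s)%:E * (normal_pdf 0 s v)%:E))%E).
  apply: ge0_le_integral => //.
  - by move=> v _; exact: omega_integrand_ge0.
  - by apply/measurable_EFinP; exact: measurable_wnorm_integrand.
  - apply: measurable_funeM; apply/measurable_EFinP.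
    exact: measurable_normal_pdf.
  - by move=> v _; rewrite -EFinM -gaussE lee_fin.
rewrite ge0_integralZl //; last 2 first.
- by apply/measurable_EFinP; exact: measurable_normal_pdf.
- by move=> v _; rewrite lee_fin normal_pdf_ge0.
by rewrite integral_normal_pdf mule1 ltry.
Qed.

Lemma wnorm_eq_pinfty {R : realType} (beta C : R) (u : R -> R) :
  measurable_fun [set: R] u -> 0 < C ->
  (forall v, C <= `|u v| ^+ 2 * omega beta v) -> wnorm beta u = +oo%E.
Proof.
move=> mu C0 lb.
suff I :
  (\int[@lebesgue_measure R]_v (`|u v| ^+ 2 * omega beta v)%:E)%E = +oo%E.
  by rewrite /wnorm I.
apply/eqP; rewrite -leye_eq.
have RT : (@lebesgue_measure R) [set: R] = +oo%E.
  by rewrite -set_itvNyy lebesgue_measure_itv.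
have <- : (\int[@lebesgue_measure R]_v (cst C%:E v) = +oo)%E.
  rewrite integral_cst // [X in (_ * X)%E]RT.
  by rewrite gt0_muley.
apply: ge0_le_integral => //.
- by move=> v _; rewrite lee_fin ltW.
- by apply/measurable_EFinP; exact: measurable_wnorm_integrand.
- by move=> v _; rewrite lee_fin.
Qed.

Theorem proposition3p1 (R : realType) (L k : R) (L_gt0 : 0 < L) (k_gt0 : 0 < k)
    (kL : exists m : int, k * L = 2 * pi * m%:~R) :
  exists alpha0 : R, (0 < alpha0 /\ alpha0 < 1) /\
    forall alpha : R, `|alpha| <= alpha0 ->
    forall (rho0 : R) (f : R -> R -> R -> R) (phi : R -> R -> R),
      vlasov_poisson_solution L rho0 (perturbed_maxwellian alpha k) f phi ->
    forall x t : R, 0 <= x <= L -> 0 < t ->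
      (forall beta : R, 0 < beta -> beta < Num.sqrt 2 ->
         (wnorm beta (f t x) < +oo)%E) /\
      (forall beta : R, Num.sqrt 2 < beta ->
         wnorm beta (f t x) = +oo%E).
Proof.
(* for [`|alpha| <= 1 / 2] the factor [1 + alpha * cos (k * x)] stays between
   positive constants, so that [f] is also bounded below by a Maxwellian *)
exists 2^-1; split; first by split; lra.
move=> alpha alpha_le rho0 f phi fS x t _ t0.
have [a fbd] := vlasov_poisson_gaussian_bounds x L_gt0 t0 alpha_le fS.
have N0 : 0 < (Num.sqrt (2 * pi) : R).
  by rewrite sqrtr_gt0 mulr_gt0 // pi_gt0.
have mf : measurable_fun [set: R] (f t x).
  by apply/measurable_EFinP; case/integrableP: (vp_f_integrable fS x (ltW t0)).
have f_lower (d : R) v : 0 < d ->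
    2^-1 / Num.sqrt (2 * pi) *
    expR (- (((1 + d) * v ^+ 2 + (1 + d^-1) * a ^+ 2) / 2)) <= f t x v.
  by move=> d0; apply: (fbd v _).2 => w; exact: sqr_peter_paul.
have f_ge0 v : 0 <= f t x v.
  apply: le_trans (f_lower 1 v ltr01).
  by rewrite mulr_ge0 ?expR_ge0 // divr_ge0 // ltW.
have f_upper (d : R) v : 0 < d ->
    f t x v <= 2 / Num.sqrt (2 * pi) *
    expR (- ((v ^+ 2 - (1 + d^-1) * a ^+ 2) / (1 + d) / 2)).
  move=> d0; apply: (fbd v _).1 => w wv.
  rewrite ler_pdivrMr; last lra.
  by rewrite lerBlDr mulrC; apply: sqr_peter_paul => //; rewrite distrC.
have sqrt2_sqr : (Num.sqrt 2 : R) ^+ 2 = 2 by rewrite sqr_sqrtr.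
split=> beta.
  move=> beta0 beta_lt.
  pose q := beta ^+ 2 / 2.
  have q0 : 0 < q by rewrite divr_gt0 // exprn_gt0.
  have q1 : q < 1.
    rewrite ltr_pdivrMr // mul1r -sqrt2_sqr.
    by rewrite ltr_pXn2r // nnegrE ?sqrtr_ge0 ?ltW.
  (* [1 + d = 2 / (1 + q)], which makes [1 / (1 + d)] the midpoint of [q] and 1:
     the exponent [- v ^+ 2 / (1 + d) + q * v ^+ 2] is then negative *)
  pose d := (1 - q) / (1 + q).
  have d0 : 0 < d by rewrite divr_gt0; lra.
  pose A := 2 / Num.sqrt (2 * pi) : R.
  pose D := (1 + d^-1) * a ^+ 2 / (1 + d).
  apply: (@wnorm_lt_pinfty _ _ (A ^+ 2 * expR D) ((1 - q) / 2)) => //.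
  - by rewrite mulr_ge0 ?expR_ge0 // sqr_ge0.
  - lra.
  move=> v; rewrite ger0_norm //.
  have := f_upper d v d0; set m := _ / (1 + d) / 2 => fle.
  have f2 : f t x v ^+ 2 <= A ^+ 2 * expR (- m) ^+ 2.
    by rewrite -exprMn ler_pXn2r // nnegrE //; exact: le_trans fle.
  apply: le_trans (ler_wpM2r (expR_ge0 _) f2) _.
  rewrite -[leLHS]mulrA -[leRHS]mulrA ler_wpM2l ?sqr_ge0 // /omega.
  rewrite -expRM_natl -!expRD ler_expR.
  have dE : (1 + d)^-1 = (1 + q) / 2.
    by rewrite /d; field; apply/andP; split; rewrite gt_eqF //; lra.
  rewrite le_eqVlt; apply/orP; left; apply/eqP.
  by rewrite /m /D dE; move: (1 + d^-1) => b; rewrite /q; field.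
move=> beta_gt.
(* with this weight the Gaussian lower bound exactly cancels [omega beta] *)
pose d := beta ^+ 2 / 2 - 1.
have d0 : 0 < d.
  rewrite subr_gt0 ltr_pdivlMr // mul1r -sqrt2_sqr.
  rewrite ltr_pXn2r // nnegrE ?sqrtr_ge0 //.
  by rewrite ltW // (le_lt_trans _ beta_gt) // sqrtr_ge0.
pose A := 2^-1 / Num.sqrt (2 * pi) : R.
have A0 : 0 < A by rewrite divr_gt0.
apply: (@wnorm_eq_pinfty _ _ (A ^+ 2 * expR (- ((1 + d^-1) * a ^+ 2)))) => //.
  by rewrite mulr_gt0 ?expR_gt0 // exprn_gt0.
move=> v; rewrite ger0_norm //.
have := f_lower d v d0; set m := _ / 2 => fle.
have f2 : A ^+ 2 * expR (- m) ^+ 2 <= f t x v ^+ 2.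
  by rewrite -exprMn ler_pXn2r // nnegrE // mulr_ge0 ?expR_ge0 // ltW.
apply: le_trans (ler_wpM2r (expR_ge0 _) f2).
rewrite -[leRHS]mulrA ler_wpM2l ?sqr_ge0 // /omega.
rewrite -expRM_natl -!expRD ler_expR.
have betaE : beta ^+ 2 = 2 * (1 + d) by rewrite /d; field.
rewrite le_eqVlt; apply/orP; left; apply/eqP.
by rewrite /m betaE; field; rewrite gt_eqF.
Qed.
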